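(* Let $D$ be a condensed domain and let $a,b$ be two nonzero non-units of $D$. Then the following hold. (a) If $(a,b)_v=D$, then $(a,b)=D$. (b) If $I$ is a $t$-invertible ideal of $D$, then $I$ is invertible and hence principal.
   Context: Let $D$ be an integral domain with quotient field $K$. For nonzero ideals $I,J$ of $D$, the product $IJ$ is condensed if $IJ=\{ij : i\in I,\ j\in J\}$; $D$ is a condensed domain if $IJ$ is condensed for every pair of nonzero ideals $I,J$. For a nonzero fractional ideal $A$ of $D$, $A^{-1}=\{x\in K : xA\subseteq D\}$, $A_v=(A^{-1})^{-1}$, and $A_t=\bigcup\{H_v : H \text{ a nonzero finitely generated subideal of } A\}$. A nonzero ideal $I$ is $t$-invertible if $(II^{-1})_t=D$. (The condition $(a,b)_v=D$ for nonzero $a,b$ is equivalent to $aD\cap bD=abD$.) *)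

(* Defs.v *)
From HB Require Import structures.
From mathcomp Require Import all_boot all_order all_algebra.
From mathcomp Require Import all_classical.

Set Implicit Arguments.
Unset Strict Implicit.
Unset Printing Implicit Defensive.

Import GRing.Theory.
Local Open Scope classical_set_scope.
Local Open Scope ring_scope.

Notation "x %:F" := (@tofrac _ x) : ring_scope.

Section SubsetsOfRings.
Variable R : comNzRingType.
Implicit Types A B : set R.

Definition nonzero A : Prop := exists2 x, A x & x != 0.

(* The product of two ideals, or of two fractional ideals when R is the
   quotient field: all finite sums of products. *)
Definition ideal_mul A B : set R :=
  [set x | exists (n : nat) (f g : 'I_n -> R),
     [/\ forall i, A (f i), forall i, B (g i) & x = \sum_(i < n) f i * g i]].

Definition is_ideal A : Prop :=
  [/\ A 0, forall x y, A x -> A y -> A (x + y)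
    & forall r x, A x -> A (r * x)].

Definition nonzero_ideal A : Prop := is_ideal A /\ nonzero A.

Definition ideal_gen (s : seq R) : set R :=
  [set x | exists c : 'I_(size s) -> R, x = \sum_(i < size s) c i * s`_i].

Definition principal A : Prop := exists x : R, A = ideal_gen [:: x].

Definition condensed_product A B : Prop :=
  ideal_mul A B = [set i * j | i in A & j in B].

End SubsetsOfRings.

Definition condensed_domain (D : idomainType) : Prop :=
  forall I J : set D, nonzero_ideal I -> nonzero_ideal J ->
    condensed_product I J.

(* Fractional ideals of D are handled as subsets of {fraction D}; an ideal I
   of D is viewed there through its image frac_ideal I. *)
Section FractionalIdeals.
Variable D : idomainType.
Implicit Types A : set {fraction D}.

Definition frac_ideal (I : set D) : set {fraction D} := [set x%:F | x in I].

Definition frac_one : set {fraction D} := frac_ideal setT.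

Definition frac_inv A : set {fraction D} :=
  [set x | forall y, A y -> frac_one (x * y)].

Definition v_closure A : set {fraction D} := frac_inv (frac_inv A).

(* The D-submodule (not the ideal) of {fraction D} generated by s. *)
Definition frac_gen (s : seq {fraction D}) : set {fraction D} :=
  [set x | exists c : 'I_(size s) -> D,
     x = \sum_(i < size s) (c i)%:F * s`_i].

Definition t_closure A : set {fraction D} :=
  [set x | exists s : seq {fraction D},
     [/\ frac_gen s `<=` A, nonzero (frac_gen s) & v_closure (frac_gen s) x]].

Definition invertible (I : set D) : Prop :=
  ideal_mul (frac_ideal I) (frac_inv (frac_ideal I)) = frac_one.

Definition t_invertible (I : set D) : Prop :=
  t_closure (ideal_mul (frac_ideal I) (frac_inv (frac_ideal I))) = frac_one.

End FractionalIdeals.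

Arguments frac_one D : clear implicits.

(* Main.v *)
(* The key fact is that in a condensed domain D every finitely generated
   nonzero ideal H with H^-1 = D equals D; part (a) is the case of two
   generators. Suppose H is contained in a prime ideal M and let a, b be two of
   its generators. Since (a^2,b^2)(a,b) is condensed, a^3 + b^3 is a product
   (x a^2 + y b^2)(z a + w b), so a/b is a root of the cubic with coefficients
   xz - 1, xw, yz, yw - 1, which do not all lie in M. Hence some form G in a, b
   with coefficients in D, of degree at most 2, divides all monomials
   a^i b^j with i + j = N in the localization D_M, and replacing a, b by G keeps
   the property that t in K is in D_M as soon as t H is. Descending to a single
   generator f in M gives 1/f in D_M, a contradiction.
   For (b), I I^-1 contains such an H, hence 1; then a nonzero a in I lies in
   the product of I and a I^-1, so a = i j with i in I and j in a I^-1,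
   whence I = i D. *)
Require Import Defs.
From mathcomp Require Import all_boot all_order all_algebra.
From mathcomp Require Import all_classical.
From mathcomp Require Import ring.

Set Implicit Arguments.
Unset Strict Implicit.
Unset Printing Implicit Defensive.

Import GRing.Theory.
Local Open Scope classical_set_scope.
Local Open Scope ring_scope.

(** * Ideals and prime ideals *)

Section Ideals.
Variable R : comNzRingType.
Implicit Types (A : set R) (s : seq R).

Lemma ideal0 A : is_ideal A -> A 0.
Proof. by case. Qed.

Lemma idealD A x y : is_ideal A -> A x -> A y -> A (x + y).
Proof. by case=> _ + _; apply. Qed.

Lemma idealMl A r x : is_ideal A -> A x -> A (r * x).
Proof. by case=> _ _; apply. Qed.

Lemma idealMr A r x : is_ideal A -> A x -> A (x * r).
Proof. by rewrite mulrC; apply: idealMl. Qed.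

Lemma idealB A x y : is_ideal A -> A x -> A y -> A (x - y).
Proof.
by move=> iA Ax Ay; rewrite -mulN1r; apply: idealD => //; exact: idealMl.
Qed.

Lemma ideal_gen_ideal s : is_ideal (ideal_gen s).
Proof.
split.
- by exists (fun=> 0); rewrite big1// => i _; rewrite mul0r.
- move=> _ _ [c ->] [d ->]; exists (fun i => c i + d i).
  by rewrite -big_split; apply: eq_bigr => i _; rewrite mulrDl.
- move=> r _ [c ->]; exists (fun i => r * c i).
  by rewrite mulr_sumr; apply: eq_bigr => i _; rewrite mulrA.
Qed.

Lemma mem_ideal_gen s x : x \in s -> ideal_gen s x.
Proof.
move=> xs; have xi : (index x s < size s)%N by rewrite index_mem.
exists (fun i => (i == Ordinal xi)%:R).
rewrite (bigD1 (Ordinal xi))//= eqxx mul1r nth_index// big1 ?addr0// => i ne.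
by rewrite (negbTE ne) mul0r.
Qed.

Lemma ideal_gen2P x y z :
  ideal_gen [:: x; y] z <-> exists c d : R, z = c * x + d * y.
Proof.
split=> [[c ->]|[c [d ->]]].
  by exists (c ord0), (c (lift ord0 ord0)); rewrite big_ord_recl big_ord1.
have iG := ideal_gen_ideal [:: x; y].
by apply: idealD => //; apply: idealMl => //; apply: mem_ideal_gen;
  rewrite !inE eqxx ?orbT.
Qed.

Lemma ideal_gen1P x z : ideal_gen [:: x] z <-> exists c : R, z = c * x.
Proof.
split=> [[c ->]|[c ->]]; first by exists (c ord0); rewrite big_ord1.
apply: idealMl; first exact: ideal_gen_ideal.
by apply: mem_ideal_gen; rewrite inE.
Qed.

Lemma eq_setT_ideal A : is_ideal A -> A 1 -> A = [set: R].
Proof.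
move=> iA A1; apply/seteqP; split=> // x _.
by rewrite -[x]mulr1; apply: idealMl.
Qed.

Lemma prime_ideal_exists A : is_ideal A -> ~ A 1 ->
  exists M, [/\ is_ideal M, ~ M 1, forall x y, M (x * y) -> M x \/ M y
              & A `<=` M].
Proof.
move=> iA A1.
pose P := [set M : set R | M = set0 \/ [/\ is_ideal M, ~ M 1 & A `<=` M]].
have [|M [PM maxM]] := @Zorn_bigcup _ P.
  move=> F FP Ftot.
  have [[B FB [b Bb]]|noB] := pselect (exists2 B, F B & B !=set0); last first.
    left; rewrite -subset0 => x [B FB Bx]; apply: noB; exists B => //.
    by exists x.
  right.
  have FI C x : F C -> C x -> [/\ is_ideal C, ~ C 1 & A `<=` C].
    by move=> FC Cx; case: (FP _ FC) => // C0; rewrite C0 in Cx.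
  have [iB _ AB] := FI _ _ FB Bb.
  split; last by move=> x Ax; exists B => //; apply: AB.
    split; first by exists B => //; exact: ideal0.
      move=> x y [X FX Xx] [Y FY Yy].
      have [iX _ _] := FI _ _ FX Xx; have [iY _ _] := FI _ _ FY Yy.
      case: (Ftot _ _ FX FY) => sub.
        by exists Y => //; apply: idealD => //; apply: sub.
      by exists X => //; apply: idealD => //; apply: sub.
    move=> r x [X FX Xx]; have [iX _ _] := FI _ _ FX Xx.
    by exists X => //; apply: idealMl.
  by case=> X FX X1; have [_] := FI _ _ FX X1.
have {PM} [iM M1 AM] : [/\ is_ideal M, ~ M 1 & A `<=` M].
  case: PM => // M0; exfalso; apply: (maxM A); last by right; split.
  by rewrite M0; split=> // sA; have := sA 0 (ideal0 iA).
exists M; split=> // x y Mxy.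
have [Mx|nMx] := pselect (M x); [by left | right].
pose B := [set u | exists m r, M m /\ u = m + r * x].
have sMB : M `<=` B by move=> m Mm; exists m, 0; rewrite mul0r addr0.
have iB : is_ideal B.
  split.
  - by apply: sMB; apply: ideal0.
  - move=> _ _ [m [r [Mm ->]]] [m' [r' [Mm' ->]]].
    by exists (m + m'), (r + r'); split; [exact: idealD | ring].
  - move=> q _ [m [r [Mm ->]]]; exists (q * m), (q * r).
    by split; [exact: idealMl | ring].
have [[m [r [Mm E]]]|B1] := pselect (B 1).
  rewrite -[y]mul1r E mulrDl -mulrA.
  by apply: idealD => //; [exact: idealMr | exact: idealMl].
exfalso; apply: (maxM B); last by right; split=> // z /AM /sMB.
split=> // sBM; apply: nMx; apply: sBM; exists 0, 1.
by rewrite mul1r add0r; split=> //; apply: ideal0.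
Qed.

(** For [M] prime, the saturated ideals are the contractions of ideals of the localization at [M];
    elements outside [M] act as units. *)
Definition saturated (M P : set R) : Prop :=
  forall r x, ~ M r -> P (r * x) -> P x.

End Ideals.

Lemma tofrac_inj (D : idomainType) : injective (@tofrac D).
Proof. by move=> x y /eqP; rewrite tofrac_eq => /eqP. Qed.

Lemma condensed_cubes (D : idomainType) (a b : D) :
  condensed_domain D -> a != 0 -> b != 0 ->
  exists x y z w : D,
    (x * a ^+ 2 + y * b ^+ 2) * (z * a + w * b) = a ^+ 3 + b ^+ 3.
Proof.
move=> cD a0 b0.
pose I := ideal_gen [:: a ^+ 2; b ^+ 2]; pose J := ideal_gen [:: a; b].
have : ideal_mul I J (a ^+ 3 + b ^+ 3).
  exists 2%N, (fun i => [:: a ^+ 2; b ^+ 2]`_i), (fun i => [:: a; b]`_i).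
  split; last by rewrite big_ord_recl big_ord1 /= !exprSr.
    by move=> i; apply: mem_ideal_gen; apply: mem_nth.
  by move=> i; apply: mem_ideal_gen; apply: mem_nth.
have nzI : nonzero_ideal I.
  split; first exact: ideal_gen_ideal.
  exists (a ^+ 2); rewrite ?expf_neq0//.
  by apply: mem_ideal_gen; rewrite inE eqxx.
have nzJ : nonzero_ideal J.
  split; first exact: ideal_gen_ideal.
  by exists a => //; apply: mem_ideal_gen; rewrite inE eqxx.
rewrite (cD _ _ nzI nzJ) => -[_ /ideal_gen2P [x [y ->]]].
move=> [_ /ideal_gen2P [z [w ->]] E].
by exists x, y, z, w.
Qed.

(** * Localization at a prime ideal *)

Section PrimeIdeal.
Variables (D : idomainType) (M : set D).
Hypotheses (iM : is_ideal M) (M1 : ~ M 1).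
Hypothesis prM : forall x y, M (x * y) -> M x \/ M y.

Let nM_mul x y : ~ M x -> ~ M y -> ~ M (x * y).
Proof. by move=> nx ny /prM[]. Qed.

(* Up to saturation at M, some power of (a,b) lies in (G): G is chosen coprime
   modulo M to the binary cubic relation between a and b. When the extreme
   coefficients of the cubic lie in M, it vanishes modulo M at 0 and infinity
   and at one more point; over a residue field with two elements there is no
   room for a linear G, hence the quadratic forms. *)
Lemma principal_radical_pair (a b : D) : condensed_domain D -> M a -> M b ->
  exists2 G, M G & forall P, is_ideal P -> saturated M P -> P G ->
    exists N, forall i j, (i + j = N)%N -> P (a ^+ i * b ^+ j).
Proof.
move=> cD Ma Mb.
have [a0|a0] := eqVneq a 0.
  exists b => // P iP _ Pb; exists 1%N => -[|i] j /= ij.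
    by rewrite add0n in ij; rewrite ij; apply: idealMl.
  by rewrite a0 exprS !mul0r; apply: ideal0.
have [b0|b0] := eqVneq b 0.
  exists a => // P iP _ Pa; exists 1%N => i [|j] ij.
    by rewrite addn0 in ij; rewrite ij; apply: idealMr.
  by rewrite b0 exprS mul0r mulr0; apply: ideal0.
have [x [y [z [w E]]]] := condensed_cubes cD a0 b0.
pose c3 := x * z - 1; pose c2 := x * w.
pose c1 := y * z; pose c0 := y * w - 1.
have F0 : c3 * a ^+ 3 + c2 * a ^+ 2 * b + c1 * a * b ^+ 2 + c0 * b ^+ 3 = 0.
  by move/eqP: E; rewrite -subr_eq0 => /eqP <-; rewrite /c3 /c2 /c1 /c0; ring.
(* If [c3] is a unit at [M], the cubic puts a^3 in (b) locally, so G = b works with N = 3; the case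
   of [c0] is symmetric. *)
have [c3M|c3M] := pselect (M c3); last first.
  exists b => // P iP sP Pb; exists 3%N => i [|j] ij; last first.
    by rewrite exprS mulrCA; apply: idealMr.
  rewrite addn0 in ij; rewrite ij mulr1; apply: (sP _ _ c3M).
  suff -> : c3 * a ^+ 3 = b * (- c2 * a ^+ 2 - c1 * a * b - c0 * b ^+ 2).
    exact: idealMr.
  by apply: subr0_eq; rewrite -F0; ring.
have [c0M|c0M] := pselect (M c0); last first.
  exists a => // P iP sP Pa; exists 3%N => -[|i] j ij; last first.
    by rewrite exprS -mulrA; apply: idealMr.
  rewrite add0n in ij; rewrite ij mul1r; apply: (sP _ _ c0M).
  suff -> : c0 * b ^+ 3 = a * (- c3 * a ^+ 2 - c1 * b ^+ 2 - c2 * a * b).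
    exact: idealMr.
  by apply: subr0_eq; rewrite -F0; ring.
(* c2 c1 = (xz)(yw) = (c3 + 1)(c0 + 1), which is 1 modulo [M]. *)
have c12 : ~ M (c2 * c1).
  move=> c12; apply: M1.
  have -> : 1 = c2 * c1 - c3 - c0 * (x * z) by rewrite /c3 /c2 /c1 /c0; ring.
  by apply: idealB => //; [exact: idealB | exact: idealMr].
(* Modulo [M] the cubic is ab(c2 a + c1 b). The form a^2 + tab + b^2 takes the value 1 at (1,0) and
   (0,1), and the value below at the third zero (c1,-c2). If t = 0 fails, t = 1 works because c1 c2
   is not in [M]. *)
have [t ht] : exists t, ~ M (c1 ^+ 2 + c2 ^+ 2 - t * c1 * c2).
  have [q|q] := pselect (M (c1 ^+ 2 + c2 ^+ 2)).
    exists 1 => q'; apply: c12.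
    have -> : c2 * c1 = c1 ^+ 2 + c2 ^+ 2 - (c1 ^+ 2 + c2 ^+ 2 - 1 * c1 * c2).
      by ring.
    exact: idealB.
  by exists 0; rewrite !mul0r subr0.
pose A := c3 * (t ^+ 2 - 1) - c2 * t + c1; pose B := c3 * t - c2 + c0.
pose s := (B - t * A) * B + A ^+ 2.
(* The remainder of the cubic modulo G is A a b^2 + B b^3, and s is the
   resultant of the cubic and G. *)
have sM : ~ M s.
  move=> sM; apply: ht.
  pose e := c3 * t + c0.
  have Me : M e by apply: idealD => //; apply: idealMr.
  have -> : c1 ^+ 2 + c2 ^+ 2 - t * c1 * c2 =
      s - e * (e - 2 * c2 - t * (c1 - t * c2))
      - c3 * ((t ^+ 2 - 1) * (2 * (c1 - t * c2) + c3 * (t ^+ 2 - 1) - t * B)).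
    by rewrite /s /A /B /e; ring.
  by apply: idealB => //; [apply: idealB => // | ]; apply: idealMr.
pose G := a ^+ 2 + t * a * b + b ^+ 2; exists G.
  apply: idealD => //; last exact: idealMl.
  by apply: idealD => //; [exact: idealMl | rewrite mulrAC; exact: idealMl].
move=> P iP sP PG.
have PAB : P (A * (a * b ^+ 2) + B * b ^+ 3).
  suff -> : A * (a * b ^+ 2) + B * b ^+ 3 =
      G * (t * c3 * b - c3 * a - c2 * b).
    exact: idealMr.
  by apply: subr0_eq; rewrite -F0 /A /B /G; ring.
(* Let R be the remainder. Modulo [G], aR = (B - tA)ab^3 - A b^4 and bR = A ab^3 + B b^4, a linear
   system of determinant [s]. Cramer's rule gives b^4 and ab^3; the other monomials of degree 4
   follow from a^2 = -tab - b^2 modulo [G]. *)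
have P04 : P (b ^+ 4).
  apply: (sP _ _ sM).
  have -> : s * b ^+ 4 =
      (A * (a * b ^+ 2) + B * b ^+ 3) * (b * (B - t * A) - A * a)
      + G * (A ^+ 2 * b ^+ 2).
    by rewrite /s /G; ring.
  by apply: idealD => //; exact: idealMr.
have P13 : P (a * b ^+ 3).
  apply: (sP _ _ sM).
  have -> : s * (a * b ^+ 3) =
      (A * (a * b ^+ 2) + B * b ^+ 3) * (A * b + B * a)
      - G * (A * B * b ^+ 2).
    by rewrite /s /G; ring.
  by apply: idealB => //; exact: idealMr.
have P22 : P (a ^+ 2 * b ^+ 2).
  have -> : a ^+ 2 * b ^+ 2 = G * b ^+ 2 - t * (a * b ^+ 3) - b ^+ 4
    by rewrite /G; ring.
  by do 2?apply: idealB => //; [exact: idealMr | exact: idealMl].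
have P31 : P (a ^+ 3 * b).
  have -> : a ^+ 3 * b = G * (a * b) - t * (a ^+ 2 * b ^+ 2) - a * b ^+ 3
    by rewrite /G; ring.
  by do 2?apply: idealB => //; [exact: idealMr | exact: idealMl].
have P40 : P (a ^+ 4).
  have -> : a ^+ 4 = G * a ^+ 2 - t * (a ^+ 3 * b) - a ^+ 2 * b ^+ 2
    by rewrite /G; ring.
  by do 2?apply: idealB => //; [exact: idealMr | exact: idealMl].
exists 4 => -[|[|[|[|[|i]]]]] [|[|[|[|[|j]]]]] //= _; by rewrite ?mul1r ?mulr1.
Qed.

Definition in_loc (t : {fraction D}) : Prop :=
  exists s d : D, ~ M s /\ s%:F * t = d%:F.

(** The contraction to [D] of the conductor of [t] into D_M; it plays the role of P in
    [principal_radical_pair]. *)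
Definition loc_denom (t : {fraction D}) : set D := [set d | in_loc (d%:F * t)].

Lemma loc_denom_ideal t : is_ideal (loc_denom t).
Proof.
split.
- by exists 1, 0; split=> //; rewrite tofrac0 mul0r mulr0.
- move=> x y [s [d [sM E]]] [s' [d' [sM' E']]].
  exists (s * s'), (s' * d + s * d'); split; first exact: nM_mul.
  by rewrite !tofracD !tofracM -E -E'; ring.
- move=> r x [s [d [sM E]]]; exists s, (r * d); split=> //.
  by rewrite !tofracM -E; ring.
Qed.

Lemma loc_denom_saturated t : saturated M (loc_denom t).
Proof.
move=> r x rM [s [d [sM E]]]; exists (s * r), d; split; first exact: nM_mul.
by rewrite -E !tofracM; ring.
Qed.

(** The local form of H^-1 = D: the elements of K that multiply [L] into D_M are those of D_M. *)
Definition loc_dense (L : seq D) : Prop :=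
  forall t, (forall h, h \in L -> loc_denom t h) -> in_loc t.

(** If t multiplies [G] and [L] into D_M, then t a^i b^j is in D_M whenever i + j = N. In degree one
    less, t a^i b^j is multiplied into D_M by a, by b and by [L], hence lies in D_M by density. At
    degree 0 this is t itself. *)
Lemma loc_dense_pair (a b G : D) (L : seq D) :
  (forall P, is_ideal P -> saturated M P -> P G ->
    exists N, forall i j, (i + j = N)%N -> P (a ^+ i * b ^+ j)) ->
  loc_dense (a :: b :: L) -> loc_dense (G :: L).
Proof.
move=> hG dense t ht.
have [N hN] : exists N, forall i j, (i + j = N)%N ->
    loc_denom t (a ^+ i * b ^+ j).
  apply: hG; [exact: loc_denom_ideal | exact: loc_denom_saturated |].
  by apply: ht; rewrite inE eqxx.
elim: N hN => [|N IH] hN.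
  by have := hN 0 0 erefl; rewrite /loc_denom /= mul1r tofrac1 mul1r.
apply: IH => i j ij; apply: dense => h; rewrite !inE.
rewrite /loc_denom /= mulrA -tofracM => /or3P[/eqP->|/eqP->|hL].
- by rewrite mulrA -exprS; apply: hN; rewrite addSn ij.
- by rewrite mulrCA -exprS; apply: hN; rewrite addnS ij.
- have := idealMr (a ^+ i * b ^+ j) (loc_denom_ideal t) (ht h _).
  by apply; rewrite inE hL orbT.
Qed.

Lemma loc_dense_notin (L : seq D) (m : D) : condensed_domain D ->
  M m -> m != 0 -> loc_dense L -> exists2 h, h \in L & ~ M h.
Proof.
move=> cD Mm m0 dL.
have [//|nL] := pselect (exists2 h, h \in L & ~ M h); exfalso.
have {nL} LM h : h \in L -> M h.
  by move=> hL; have [//|nMh] := pselect (M h); case: nL; exists h.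
have inv_notin x : M x -> x != 0 -> ~ in_loc (x%:F^-1).
  move=> Mx x0 [s [d [sM E]]]; apply: sM.
  have xF0 : x%:F != 0 by rewrite tofrac_eq0.
  have -> : s = d * x.
    by apply: tofrac_inj; rewrite tofracM -E mulfVK.
  exact: idealMl.
elim: {L}(size L) {-2}L (erefl (size L)) dL LM => [|n IH] [|a [|b L]]//=.
(* Density of the empty list, or of the list of 0 alone, would force D_M = K, which 1/m refutes. *)
- by move=> _ d0 _; apply: (inv_notin m) => //; apply: d0.
- move=> _ da LM; have Ma : M a by apply: LM; rewrite inE eqxx.
  have [a0|a0] := eqVneq a 0.
    apply: (inv_notin m) => //; apply: da => h; rewrite inE => /eqP ->.
    by rewrite a0; apply: ideal0; apply: loc_denom_ideal.
  apply: (inv_notin a) => //; apply: da => h; rewrite inE => /eqP ->.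
  by exists 1, 1; split=> //; rewrite mulfV ?tofrac_eq0// mulr1.
- move=> [sz] dL LM.
  have [G MG hG] : exists2 G, M G &
      forall P, is_ideal P -> saturated M P -> P G ->
        exists N, forall i j, (i + j = N)%N -> P (a ^+ i * b ^+ j).
    by apply: principal_radical_pair => //; apply: LM; rewrite !inE eqxx ?orbT.
  apply: (IH (G :: L)); [by rewrite /= sz | exact: (loc_dense_pair hG) |].
  move=> h; rewrite inE => /orP[/eqP->//|hL].
  by apply: LM; rewrite !inE hL !orbT.
Qed.

End PrimeIdeal.

(** * From local to global; invertible ideals *)

Section CondensedDomain.
Variable D : idomainType.
Hypothesis cD : condensed_domain D.

Lemma condensed_dense_unit (L : seq D) (m : D) : m \in L -> m != 0 ->
  (forall t : {fraction D}, (forall h, h \in L -> frac_one D (h%:F * t)) ->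
     frac_one D t) ->
  ideal_gen L 1.
Proof.
move=> mL m0 dense; have [//|L1] := pselect (ideal_gen L 1); exfalso.
have [M [iM M1 prM LM]] := prime_ideal_exists (ideal_gen_ideal L) L1.
have [h hL] : exists2 h, h \in L & ~ M h.
  apply: (@loc_dense_notin _ M iM M1 prM L m) => //.
    by apply: LM; apply: mem_ideal_gen.
  move=> t ht.
  (* As [L] is finite, the denominators of the products h t have a common multiple [s] outside [M];
     global density then applies to s t. *)
  have [s sM hs] : exists2 s, ~ M s &
      forall h, h \in L -> frac_one D (h%:F * (s%:F * t)).
    elim: L ht {mL dense L1 LM} => [|a L IH] ht; first by exists 1.
    have [|s sM hs] := IH; first by move=> h hL; apply: ht; rewrite inE hL orbT.
    have [|s' [d [sM' E]]] := ht a; first by rewrite inE eqxx.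
    exists (s * s'); first by move=> /prM[].
    move=> h; rewrite inE => /orP[/eqP->|hL].
      by exists (s * d) => //; rewrite !tofracM -E; ring.
    have [e _ Ee] := hs h hL.
    by exists (s' * e) => //; rewrite !tofracM Ee; ring.
  by have [d _ E] := dense _ hs; exists s, d.
by apply; apply: LM; apply: mem_ideal_gen.
Qed.

Lemma condensed_v_comaximal (a b : D) : a != 0 ->
  v_closure (frac_ideal (ideal_gen [:: a; b])) = frac_one D ->
  ideal_gen [:: a; b] = [set: D].
Proof.
move=> a0 hv; apply: eq_setT_ideal; first exact: ideal_gen_ideal.
apply: (@condensed_dense_unit _ a) => //; first by rewrite inE eqxx.
move=> t ht.
(* That 1 lies in the v-closure means exactly that the inverse of (a,b) is contained in [D]. *)
have : v_closure (frac_ideal (ideal_gen [:: a; b])) 1 by rewrite hv; exists 1.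
move=> /(_ t); rewrite mul1r; apply => _ [_ /ideal_gen2P [c [d ->]] <-].
have [|e _ Ee] := ht a; first by rewrite inE eqxx.
have [|f _ Ef] := ht b; first by rewrite !inE eqxx orbT.
exists (c * e + d * f) => //.
by rewrite !tofracD !tofracM Ee Ef; ring.
Qed.

Lemma frac_one_D (x y : {fraction D}) :
  frac_one D x -> frac_one D y -> frac_one D (x + y).
Proof. by move=> [d _ <-] [e _ <-]; exists (d + e); rewrite ?tofracD. Qed.

Lemma frac_one_M (x y : {fraction D}) :
  frac_one D x -> frac_one D y -> frac_one D (x * y).
Proof. by move=> [d _ <-] [e _ <-]; exists (d * e); rewrite ?tofracM. Qed.

Lemma frac_one_sum n (f : 'I_n -> {fraction D}) :
  (forall i, frac_one D (f i)) -> frac_one D (\sum_(i < n) f i).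
Proof.
move=> hf; apply: (big_ind (frac_one D)) => //; last exact: frac_one_D.
by exists 0; rewrite ?tofrac0.
Qed.

Lemma frac_inv_mul_sub (I : set D) :
  ideal_mul (frac_ideal I) (frac_inv (frac_ideal I)) `<=` frac_one D.
Proof.
move=> _ [n [f [g [hf hg ->]]]]; apply: frac_one_sum => i.
by rewrite mulrC; apply: hg.
Qed.

Lemma mem_frac_gen (s : seq {fraction D}) x : x \in s -> frac_gen s x.
Proof.
move=> xs; have xi : (index x s < size s)%N by rewrite index_mem.
exists (fun i => (i == Ordinal xi)%:R).
rewrite (bigD1 (Ordinal xi))//= eqxx tofrac1 mul1r nth_index//.
by rewrite big1 ?addr0// => i ne; rewrite (negbTE ne) tofrac0 mul0r.
Qed.

Lemma frac_gen_tofrac (L : seq D) d :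
  ideal_gen L d -> frac_gen (map (@tofrac D) L) d%:F.
Proof.
move=> [c ->]; have sz := size_map (@tofrac D) L.
exists (fun i => c (cast_ord sz i)).
rewrite rmorph_sum /= (reindex (cast_ord sz)) /=; last first.
  by apply: onW_bij; exists (cast_ord (esym sz)) => i; apply: val_inj.
by apply: eq_bigr => i _; rewrite tofracM (nth_map 0) -?sz.
Qed.

Lemma condensed_t_invertible_one (I : set D) : t_invertible I ->
  ideal_mul (frac_ideal I) (frac_inv (frac_ideal I)) 1.
Proof.
move=> tI.
have [s [sQ [x sx x0] v1]] :
    t_closure (ideal_mul (frac_ideal I) (frac_inv (frac_ideal I))) 1.
  by rewrite tI; exists 1; rewrite ?tofrac1.
(* The generators of H lie in I I^-1, hence in [D], so H comes from an ideal of [D]. *)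
have [L Ls] : exists L : seq D, s = map (@tofrac D) L.
  have : forall y, y \in s -> frac_one D y.
    by move=> y ys; apply: frac_inv_mul_sub; apply: sQ; apply: mem_frac_gen.
  elim: s {sQ x sx x0 v1} => [|y s IH] hs; first by exists [::].
  have [|L ->] := IH; first by move=> z zs; apply: hs; rewrite inE zs orbT.
  have [|d _ <-] := hs y; first by rewrite inE eqxx.
  by exists (d :: L).
have sL y : y \in s -> exists2 m, m \in L & y = m%:F by rewrite Ls => /mapP.
have [m mL m0] : exists2 m, m \in L & m != 0.
  have [//|nm] := pselect (exists2 m, m \in L & m != 0); exfalso.
  move/eqP: x0; apply; case: sx => c ->; apply: big1 => i _.
  have /sL[m mL ->] : s`_i \in s by apply: mem_nth.
  have [->|m0] := eqVneq m 0; first by rewrite tofrac0 mulr0.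
  by case: nm; exists m.
suff L1 : ideal_gen L 1.
  by apply: sQ; rewrite Ls -tofrac1; apply: frac_gen_tofrac.
apply: (condensed_dense_unit mL m0) => t ht.
have := v1 t; rewrite mul1r; apply => _ [c ->].
rewrite mulr_sumr; apply: frac_one_sum => i.
have /sL[h hL ->] : s`_i \in s by apply: mem_nth.
rewrite mulrCA; apply: frac_one_M; first by exists (c i).
by rewrite mulrC; apply: ht.
Qed.

Lemma condensed_invertible_principal (I : set D) : nonzero_ideal I ->
  ideal_mul (frac_ideal I) (frac_inv (frac_ideal I)) 1 -> principal I.
Proof.
move=> [iI [a Ia a0]] [n [f [g [hf hg E]]]].
have aF0 : a%:F != 0 by rewrite tofrac_eq0.
(* This is a I^-1, which lies in [D] because a is in [I]. *)
pose J := [set d : D | frac_inv (frac_ideal I) (d%:F / a%:F)].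
have nzJ : nonzero_ideal J.
  split; last first.
    by exists a => //; move=> _ [y Iy <-]; exists y => //; rewrite mulfV ?mul1r.
  split.
  - by move=> y _; exists 0 => //; rewrite tofrac0 !mul0r.
  - move=> x y Jx Jy z Iz; rewrite tofracD !mulrDl.
    by apply: frac_one_D; [exact: Jx | exact: Jy].
  - move=> r x Jx z Iz; rewrite tofracM -!mulrA.
    apply: frac_one_M; first by exists r.
    by rewrite mulrA; apply: Jx.
have : ideal_mul I J a.
  have /choice [i hi] : forall k, exists i, I i /\ i%:F = f k.
    by move=> k; case: (hf k) => i Ii <-; exists i.
  have /choice [j hj] : forall k, exists j, j%:F = g k * a%:F.
    by move=> k; case: (hg k a%:F) => [|j _ <-]; [exists a | exists j].
  exists n, i, j; split.
  - by move=> k; case: (hi k).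
  - by move=> k; rewrite /J /= hj mulfK.
  - apply: tofrac_inj; rewrite rmorph_sum /= -[LHS]mul1r E mulr_suml.
    by apply: eq_bigr => k _; rewrite tofracM hj (hi k).2 mulrA.
rewrite (cD (conj iI _) nzJ); last by exists a.
(* For x in [I], c = jx/a is in [D], and a = ij turns this into x = ci. *)
move=> [i Ii [j Jj ij]]; exists i; apply/seteqP; split=> [x Ix|x].
  apply/ideal_gen1P; have [|c _ Ec] := Jj x%:F; first by exists x.
  exists c; apply: tofrac_inj; rewrite tofracM Ec.
  by rewrite mulrAC (mulrAC j%:F) -tofracM (mulrC j) ij mulfV ?mul1r.
by move=> /ideal_gen1P [c ->]; apply: idealMl.
Qed.

End CondensedDomain.

Theorem lemma1p1 (D : idomainType) (hD : condensed_domain D)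
    (a b : D) (a0 : a != 0) (b0 : b != 0)
    (aU : a \isn't a GRing.unit) (bU : b \isn't a GRing.unit) :
  (v_closure (frac_ideal (ideal_gen [:: a; b])) = frac_one D ->
     ideal_gen [:: a; b] = [set: D]) /\
  (forall I : set D, nonzero_ideal I -> t_invertible I ->
     invertible I /\ principal I).
Proof.
split; first exact: condensed_v_comaximal.
move=> I nzI tI; have Q1 := condensed_t_invertible_one hD tI.
split; last exact: condensed_invertible_principal.
apply/seteqP; split; first exact: frac_inv_mul_sub.
move=> _ [d _ <-]; have [n [f [g [hf hg E]]]] := Q1.
exists n, (fun i => d%:F * f i), g; split=> //.
  move=> i; have [x Ix <-] := hf i; exists (d * x); last exact: tofracM.
  by case: nzI => iI _; apply: idealMl.
rewrite -[LHS]mulr1 E mulr_sumr.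
by apply: eq_bigr => i _; rewrite mulrA.
Qed.
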